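(* Let assumptions A1 and A2 (see context) hold, let $\rho_0,\rho_1$ be two probability density functions on $\mathbb{R}^n$ having finite second moments, let $[t_0,t_1]$ be a given time horizon, and let the state cost $q$ be suitably smooth. Let the pair $(\rho^{\bm u}_{\mathrm{opt}},S)$, with $S\in\mathcal{C}^{1,2}([t_0,t_1];\mathbb{R}^n)$, solve the system $$\frac{\partial\rho^{\bm u}_{\mathrm{opt}}}{\partial t}+\nabla_{\bm x}\cdot\left(\rho^{\bm u}_{\mathrm{opt}}\left(\bm f+\bm g\bm g^{\top}\nabla_{\bm x}S\right)\right)=\tfrac12\Delta_{\bm\Sigma}\,\rho^{\bm u}_{\mathrm{opt}},$$ $$\frac{\partial S}{\partial t}+\langle\nabla_{\bm x}S,\bm f\rangle+\tfrac12\langle\nabla_{\bm x}S,\bm g\bm g^{\top}\nabla_{\bm x}S\rangle+\tfrac12\langle\bm\Sigma,\mathrm{Hess}_{\bm x}S\rangle=q,$$ $$\rho^{\bm u}_{\mathrm{opt}}(t_0,\cdot)=\rho_0(\cdot),\qquad \rho^{\bm u}_{\mathrm{opt}}(t_1,\cdot)=\rho_1(\cdot).$$ For a constant $\lambda>0$ let $\widehat\varphi:=\rho^{\bm u}_{\mathrm{opt}}\exp(-S/\lambda)$ and $\varphi:=\exp(S/\lambda)$; the pair $(\widehat\varphi,\varphi)$ solves the boundary-coupled system $$\frac{\partial\widehat\varphi}{\partial t}+\nabla_{\bm x}\cdot\left(\widehat\varphi\left(\bm f+\bm f_{\varphi}\right)\right)-\tfrac12\Delta_{\bm\Sigma}\,\widehat\varphi+\left(\frac{q}{\lambda}+q_{\varphi}\right)\widehat\varphi=0,$$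 $$\frac{\partial\varphi}{\partial t}+\langle\nabla_{\bm x}\varphi,\bm f+\bm f_{\varphi}\rangle+\tfrac12\langle\bm\Sigma,\mathrm{Hess}_{\bm x}\varphi\rangle-\left(\frac{q}{\lambda}+q_{\varphi}\right)\varphi=0,$$ $$\widehat\varphi(t_0,\cdot)\,\varphi(t_0,\cdot)=\rho_0(\cdot),\qquad \widehat\varphi(t_1,\cdot)\,\varphi(t_1,\cdot)=\rho_1(\cdot),$$ where $\bm f_{\varphi}:=(\lambda\bm g\bm g^{\top}-\bm\Sigma)\nabla_{\bm x}\log\varphi$ and $q_{\varphi}:=\tfrac12(\nabla_{\bm x}\log\varphi)^{\top}(\lambda\bm g\bm g^{\top}-\bm\Sigma)\nabla_{\bm x}\log\varphi$. If $\bm g\bm g^{\top}\propto\bm\sigma\bm\sigma^{\top}$, or equivalently, $\lambda\bm g\bm g^{\top}-\bm\Sigma=\bm 0$ for some constant $\lambda>0$, then (with this $\lambda$) the boundary-coupled system for $(\widehat\varphi,\varphi)$ involving $\bm f_{\varphi}$ and $q_{\varphi}$ reduces to the following system of linear advection-diffusion-reaction PDEs that are only coupled through bilinear boundary conditions: $$\frac{\partial\widehat\varphi}{\partial t}+\nabla_{\bm x}\cdot\left(\widehat\varphi\bm f\right)-\tfrac12\Delta_{\bm\Sigma}\,\widehat\varphi+\frac{q\widehat\varphi}{\lambda}=0,$$ $$\frac{\partial\varphi}{\partial t}+\langle\nabla_{\bm x}\varphi,\bm f\rangle+\tfrac12\langle\bm\Sigma,\mathrm{Hess}_{\bm x}\varphi\rangle-\frac{q\varphi}{\lambda}=0,$$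 $$\widehat\varphi(t_0,\cdot)\,\varphi(t_0,\cdot)=\rho_0(\cdot),\qquad \widehat\varphi(t_1,\cdot)\,\varphi(t_1,\cdot)=\rho_1(\cdot).$$
   Context: Here $\bm f:[t_0,t_1]\times\mathbb{R}^n\to\mathbb{R}^n$ is the unforced drift, $\bm g:[t_0,t_1]\times\mathbb{R}^n\to\mathbb{R}^{n\times m}$ the control coefficient, $\bm\sigma:[t_0,t_1]\times\mathbb{R}^n\to\mathbb{R}^{n\times p}$ the noise (diffusion) coefficient, and $q:[t_0,t_1]\times\mathbb{R}^n\to\mathbb{R}$ the state cost; arguments $(t,\bm x)$ are suppressed. The diffusion tensor is $\bm\Sigma:=\bm\sigma\bm\sigma^{\top}\succeq\bm 0$. Assumption A1: there exist constants $c_1,c_2>0$ such that for all $\bm x,\bm y\in\mathbb{R}^n$ and $t\in[t_0,t_1]$, $\|\bm f(t,\bm x)\|_2+\|\bm\sigma(t,\bm x)\|_2\le c_1(1+\|\bm x\|_2)$ and $\|\bm f(t,\bm x)-\bm f(t,\bm y)\|_2\le c_2\|\bm x-\bm y\|_2$. Assumption A2: there exists $c_3>0$ such that for all $\bm x\in\mathbb{R}^n$ and $t\in[t_0,t_1]$, $\langle\bm x,\bm\Sigma(t,\bm x)\bm x\rangle\ge c_3\|\bm x\|_2^2$. $\langle\cdot,\cdot\rangle$ is the Euclidean inner product for vectors and the Frobenius inner product for matrices. $\mathrm{Hess}_{\bm x}$ denotes the Hessian with respect to $\bm x$. The weighted Laplacian is $\Delta_{\bm\Sigma(t,\bm x)}\,\rho:=\sum_{i,j=1}^n\frac{\partial^2}{\partial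 x_i\partial x_j}\left(\bm\Sigma_{ij}(t,\bm x)\rho(t,\bm x)\right)$. $\mathcal{C}^{1,2}([t_0,t_1];\mathbb{R}^n)$ denotes real-valued functions of $(t,\bm x)\in[t_0,t_1]\times\mathbb{R}^n$ that are $C^1$ in $t$ and $C^2$ in $\bm x$. The system for $(\rho^{\bm u}_{\mathrm{opt}},S)$ is the system of necessary conditions for optimality (with optimal control $\bm u_{\mathrm{opt}}=\bm g^{\top}\nabla_{\bm x}S$) of the control-affine Schr\''odinger bridge problem: minimize $\int_{t_0}^{t_1}\mathbb{E}_{\rho^{\bm u}}[q(t,\bm x_t^{\bm u})+\tfrac12\|\bm u\|_2^2]\,\mathrm{d}t$ over $(\rho^{\bm u},\bm u)\in\mathcal{P}_{01}\times\mathcal{U}$ subject to $\frac{\partial\rho^{\bm u}}{\partial t}+\nabla_{\bm x}\cdot(\rho^{\bm u}(\bm f+\bm g\bm u))=\tfrac12\Delta_{\bm\Sigma}\,\rho^{\bm u}$, where $\mathcal{U}:=\{\bm v:[t_0,t_1]\times\mathbb{R}^n\to\mathbb{R}^m\mid\|\bm v\|_2^2<\infty\}$ and $\mathcal{P}_{01}$ is the set of continuous curves $t\mapsto\rho(t,\cdot)$ of probability density functions, $t\in[t_0,t_1]$, with $\rho(t_0,\cdot)=\rho_0(\cdot)$ and $\rho(t_1,\cdot)=\rho_1(\cdot)$. *)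

(* Defs.v *)
From HB Require Import structures.
From mathcomp Require Import all_boot all_order all_algebra.
From mathcomp Require Import all_classical all_reals all_analysis.
Import Order.TTheory GRing.Theory Num.Theory.
Import numFieldNormedType.Exports.

Set Implicit Arguments.
Unset Strict Implicit.
Unset Printing Implicit Defensive.

Local Open Scope classical_set_scope.
Local Open Scope ring_scope.

(* Lebesgue measure on R^n, on the product sigma-algebra of n.-tuple R: the
   n-fold product of lebesgue_measure, each step being transported along the
   identification R * n.-tuple R ~ n.+1.-tuple R. *)
Section lebesgue_tuple.
Context (R : realType).
Local Notation T := (measurableTypeR R).

Definition cons_pair (n : nat) (p : T * n.-tuple T) : n.+1.-tuple T :=
  [tuple of p.1 :: p.2].

Lemma measurable_cons_pair n : measurable_fun [set: T * n.-tuple T] (@cons_pair n).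
Proof. exact: (measurable_cons measurable_fst measurable_snd). Qed.

Lemma measurable_uncons n :
  measurable_fun [set: n.+1.-tuple T]
    (fun s : n.+1.-tuple T => (thead s, [tuple of behead s] : n.-tuple T)).
Proof.
apply/measurable_fun_pair; first exact: measurable_tnth.
exact: measurable_behead.
Qed.

Section cons_measure.
Context (n : nat) (mu : {sigma_finite_measure set (n.-tuple T) -> \bar R}).

Definition cons_measure : set (n.+1.-tuple T) -> \bar R :=
  pushforward (@lebesgue_measure R \x mu)%E (@cons_pair n).

Let cons_measure0 : cons_measure set0 = 0%E.
Proof. by rewrite /cons_measure /pushforward preimage_set0 measure0. Qed.

Let cons_measure_ge0 A : (0 <= cons_measure A)%E.
Proof. by apply: integral_ge0 => *; exact: measure_ge0. Qed.

Let cons_measure_sigma_additive : semi_sigma_additive cons_measure.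
Proof.
have mC B : measurable B -> measurable (@cons_pair n @^-1` B).
  by move=> mB; rewrite -[X in measurable X]setTI; exact: measurable_cons_pair.
move=> F mF tF mUF; rewrite /cons_measure /pushforward preimage_bigcup.
apply: measure_semi_sigma_additive.
- by move=> k; exact: mC.
- apply/trivIsetP => /= i j _ _ ij; rewrite -preimage_setI.
  by move/trivIsetP : tF => /(_ _ _ _ _ ij) ->//; rewrite preimage_set0.
- by rewrite -preimage_bigcup; exact: mC.
Qed.

HB.instance Definition _ := isMeasure.Build _ _ _ cons_measure
  cons_measure0 cons_measure_ge0 cons_measure_sigma_additive.

Let cons_measure_sigma_finite : sigma_finite setT cons_measure.
Proof.
have /sigma_finiteP[F [TF ndF mF]] := sigma_finiteT (@lebesgue_measure R).
have /sigma_finiteP[G [TG ndG mG]] := sigma_finiteT mu.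
pose u (s : n.+1.-tuple T) := (thead s, [tuple of behead s] : n.-tuple T).
have uK p : u (cons_pair p) = p.
  by case: p => x s; rewrite /u theadE; congr pair; apply/val_inj.
exists (fun k => u @^-1` (F k `*` G k)).
  rewrite -preimage_bigcup (_ : \bigcup_k _ = setT) ?preimage_setT//.
  rewrite -setXTT TF TG predeqE => -[x y]; split.
    by move=> [k _ []/= ? ?]; split; exists k.
  move=> [/= [k _ Fkx] [l _ Gly]]; exists (maxn k l) => //; split.
  - by move: x Fkx; exact/subsetPset/ndF/leq_maxl.
  - by move: y Gly; exact/subsetPset/ndG/leq_maxr.
move=> k; have [mFk Fk] := mF k; have [mGk Gk] := mG k; split.
  rewrite -[X in measurable X]setTI; apply: measurable_uncons => //.
  exact: measurableX.
rewrite /cons_measure /pushforward -comp_preimage.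
rewrite (_ : u \o _ = id); last by apply/funext => p; exact: uK.
rewrite preimage_id [X in (X < _)%E](product_measure1E _ _ mFk mGk).
by rewrite lte_mul_pinfty// ge0_fin_numE.
Qed.

HB.instance Definition _ := Measure_isSigmaFinite.Build _ _ _ cons_measure
  cons_measure_sigma_finite.
End cons_measure.

Fixpoint lebesgue_tuple (n : nat) : {sigma_finite_measure set (n.-tuple T) -> \bar R} :=
  match n with
  | 0 => @dirac _ (0.-tuple T) [tuple] R
  | k.+1 => cons_measure (lebesgue_tuple k)
  end.

End lebesgue_tuple.

Section euclidean.
Context (R : realType).

Definition inner (m n : nat) (A B : 'M[R]_(m, n)) : R :=
  \sum_i \sum_j A i j * B i j.

(* The canonical norm `|v| on matrices is the max norm. *)
Definition norm2 (n : nat) (v : 'cV[R]_n) : R := Num.sqrt (inner v v).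

(* Spectral norm, i.e. the operator norm induced by norm2. *)
Definition opnorm2 (m n : nat) (A : 'M[R]_(m, n)) : R :=
  sup [set norm2 (A *m v) | v in [set v : 'cV[R]_n | norm2 v <= 1]].

End euclidean.

Section densities.
Context (R : realType) (n : nat).

Definition vec_of_tuple (s : n.-tuple (measurableTypeR R)) : 'cV[R]_n :=
  \col_i tnth s i.

Definition is_pdf (r : 'cV[R]_n -> R) : Prop :=
  [/\ forall x, 0 <= r x,
      measurable_fun setT (fun s => r (vec_of_tuple s) : measurableTypeR R)
    & (\int[lebesgue_tuple R n]_s (r (vec_of_tuple s))%:E = 1)%E].

Definition finite_second_moment (r : 'cV[R]_n -> R) : Prop :=
  (\int[lebesgue_tuple R n]_s
     (norm2 (vec_of_tuple s) ^+ 2 * r (vec_of_tuple s))%:E < +oo)%E.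

(* The set P_01 of curves of densities; continuity of the curve is understood
   in the narrow topology (duality with bounded continuous functions). *)
Definition density_curve (t0 t1 : R) (rho0 rho1 : 'cV[R]_n -> R)
    (rho : R -> 'cV[R]_n -> R) : Prop :=
  [/\ forall t, t \in `[t0, t1] -> is_pdf (rho t),
      forall psi : 'cV[R]_n -> R, continuous psi ->
        (exists M, forall x, `|psi x| <= M) ->
        {within `[t0, t1], continuous (fun t : R =>
          \int[lebesgue_tuple R n]_s
            (psi (vec_of_tuple s) * rho t (vec_of_tuple s)))},
      rho t0 = rho0
    & rho t1 = rho1].

End densities.

Section differential_operators.
Context (R : realType) (n : nat).

Definition basis_vec (i : 'I_n) : 'cV[R]_n := delta_mx i 0.

Definition grad (F : 'cV[R]_n -> R) (x : 'cV[R]_n) : 'cV[R]_n :=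
  \col_i 'D_(basis_vec i) F x.

Definition hess (F : 'cV[R]_n -> R) (x : 'cV[R]_n) : 'M[R]_n :=
  \matrix_(i, j) 'D_(basis_vec i) ('D_(basis_vec j) F) x.

Definition divergence (X : 'cV[R]_n -> 'cV[R]_n) (x : 'cV[R]_n) : R :=
  \sum_i 'D_(basis_vec i) (fun y => X y i 0) x.

Definition wlaplacian (A : 'cV[R]_n -> 'M[R]_n) (r : 'cV[R]_n -> R)
    (x : 'cV[R]_n) : R :=
  \sum_i \sum_j
    'D_(basis_vec i) ('D_(basis_vec j) (fun y => A y i j * r y)) x.

(* 'D_v f x is a total function with an unspecified value where f is not
   derivable; the next predicates state that the derivatives occurring in the
   operators above exist. *)
Definition has_grad (F : 'cV[R]_n -> R) : Prop :=
  forall i x, derivable F x (basis_vec i).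

Definition has_hess (F : 'cV[R]_n -> R) : Prop :=
  forall j, has_grad ('D_(basis_vec j) F).

Definition has_divergence (X : 'cV[R]_n -> 'cV[R]_n) : Prop :=
  forall i x, derivable (fun y => X y i 0) x (basis_vec i).

Definition has_wlaplacian (A : 'cV[R]_n -> 'M[R]_n) (r : 'cV[R]_n -> R) : Prop :=
  forall i j,
    (forall x, derivable (fun y => A y i j * r y) x (basis_vec j)) /\
    (forall x, derivable ('D_(basis_vec j) (fun y => A y i j * r y)) x
                         (basis_vec i)).

Definition C2 (F : 'cV[R]_n -> R) : Prop :=
  [/\ has_grad F, has_hess F,
      forall i, continuous ('D_(basis_vec i) F)
    & forall i j, continuous ('D_(basis_vec i) ('D_(basis_vec j) F))].

End differential_operators.

(* C^1 on the closed interval [a, b]: the derivative, one-sided at a and b,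
   exists and is continuous on [a, b]. *)
Definition C1_itv (R : realType) (a b : R) (F : R -> R) : Prop :=
  exists dF : R -> R,
    (forall t, t \in `[a, b] ->
       (F s - F t) / (s - t) @[s --> within `[a, b] t^'] --> dF t) /\
    {within `[a, b], continuous dF}.

Definition C12 (R : realType) (n : nat) (t0 t1 : R)
    (F : R -> 'cV[R]_n -> R) : Prop :=
  (forall x, C1_itv t0 t1 (F ^~ x)) /\
  (forall t, t \in `[t0, t1] -> C2 (F t)).

(* The coefficients and unknowns are functions on R * R^n of which only the
   values at times in [t0, t1] matter. A solution of one of the systems below
   is a classical one: the equations hold on ]t0, t1[ * R^n, all the
   derivatives they contain exist there, and the boundary conditions hold at
   t0 and t1. *)
Section systems.
Context (R : realType) (n m p : nat) (t0 t1 : R).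
Context (f : R -> 'cV[R]_n -> 'cV[R]_n) (g : R -> 'cV[R]_n -> 'M[R]_(n, m))
  (sigma : R -> 'cV[R]_n -> 'M[R]_(n, p)) (q : R -> 'cV[R]_n -> R).
Implicit Types (rho S phihat phi : R -> 'cV[R]_n -> R).

Definition Sigma (t : R) (x : 'cV[R]_n) : 'M[R]_n :=
  sigma t x *m (sigma t x)^T.

Definition ggT (t : R) (x : 'cV[R]_n) : 'M[R]_n := g t x *m (g t x)^T.

Definition assumption_A1 : Prop :=
  exists c1 c2 : R, [/\ 0 < c1, 0 < c2,
    forall t x, t \in `[t0, t1] ->
      norm2 (f t x) + opnorm2 (sigma t x) <= c1 * (1 + norm2 x)
  & forall t x y, t \in `[t0, t1] ->
      norm2 (f t x - f t y) <= c2 * norm2 (x - y)].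

Definition assumption_A2 : Prop :=
  exists2 c3 : R, 0 < c3 & forall t x, t \in `[t0, t1] ->
    c3 * norm2 x ^+ 2 <= inner x (Sigma t x *m x).

Definition optimality_system (rho0 rho1 : 'cV[R]_n -> R) rho S : Prop :=
  let X t x := rho t x *: (f t x + ggT t x *m grad (S t) x) in
  [/\ forall t, t \in `]t0, t1[ ->
        [/\ forall x, derivable (rho ^~ x) t 1, has_divergence (X t)
          & has_wlaplacian (Sigma t) (rho t)],
      forall t x, t \in `]t0, t1[ ->
        derive1 (rho ^~ x) t + divergence (X t) x
        = 2^-1 * wlaplacian (Sigma t) (rho t) x,
      forall t x, t \in `]t0, t1[ ->
        derive1 (S ^~ x) t + inner (grad (S t) x) (f t x)
        + 2^-1 * inner (grad (S t) x) (ggT t x *m grad (S t) x)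
        + 2^-1 * inner (Sigma t x) (hess (S t) x)
        = q t x,
      rho t0 = rho0
    & rho t1 = rho1].

(* lambda g g^T - Sigma *)
Definition mismatch (lambda : R) (t : R) (x : 'cV[R]_n) : 'M[R]_n :=
  lambda *: ggT t x - Sigma t x.

Definition f_ (lambda : R) phi (t : R) (x : 'cV[R]_n) : 'cV[R]_n :=
  mismatch lambda t x *m grad (fun y => ln (phi t y)) x.

Definition q_ (lambda : R) phi (t : R) (x : 'cV[R]_n) : R :=
  let w := grad (fun y => ln (phi t y)) x in
  2^-1 * (w^T *m mismatch lambda t x *m w) 0 0.

Definition coupled_system (lambda : R) (rho0 rho1 : 'cV[R]_n -> R)
    phihat phi : Prop :=
  let X t x := phihat t x *: (f t x + f_ lambda phi t x) in
  [/\ forall t, t \in `]t0, t1[ ->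
        [/\ forall x, derivable (phihat ^~ x) t 1, has_divergence (X t)
          & has_wlaplacian (Sigma t) (phihat t)] /\
        [/\ forall x, derivable (phi ^~ x) t 1, has_grad (phi t)
          & has_hess (phi t)],
      forall t x, t \in `]t0, t1[ ->
        derive1 (phihat ^~ x) t + divergence (X t) x
        - 2^-1 * wlaplacian (Sigma t) (phihat t) x
        + (q t x / lambda + q_ lambda phi t x) * phihat t x = 0,
      forall t x, t \in `]t0, t1[ ->
        derive1 (phi ^~ x) t
        + inner (grad (phi t) x) (f t x + f_ lambda phi t x)
        + 2^-1 * inner (Sigma t x) (hess (phi t) x)
        - (q t x / lambda + q_ lambda phi t x) * phi t x = 0,
      forall x, phihat t0 x * phi t0 x = rho0 x
    & forall x, phihat t1 x * phi t1 x = rho1 x].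

Definition linear_system (lambda : R) (rho0 rho1 : 'cV[R]_n -> R)
    phihat phi : Prop :=
  let X t x := phihat t x *: f t x in
  [/\ forall t, t \in `]t0, t1[ ->
        [/\ forall x, derivable (phihat ^~ x) t 1, has_divergence (X t)
          & has_wlaplacian (Sigma t) (phihat t)] /\
        [/\ forall x, derivable (phi ^~ x) t 1, has_grad (phi t)
          & has_hess (phi t)],
      forall t x, t \in `]t0, t1[ ->
        derive1 (phihat ^~ x) t + divergence (X t) x
        - 2^-1 * wlaplacian (Sigma t) (phihat t) x
        + q t x * phihat t x / lambda = 0,
      forall t x, t \in `]t0, t1[ ->
        derive1 (phi ^~ x) t + inner (grad (phi t) x) (f t x)
        + 2^-1 * inner (Sigma t x) (hess (phi t) x)
        - q t x * phi t x / lambda = 0,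
      forall x, phihat t0 x * phi t0 x = rho0 x
    & forall x, phihat t1 x * phi t1 x = rho1 x].

End systems.

(* Main.v *)
Require Import Defs.
From mathcomp Require Import all_boot all_order all_algebra.
From mathcomp Require Import all_classical all_reals all_analysis.
From mathcomp Require Import ring lra.
Import Order.TTheory GRing.Theory Num.Theory.
Import numFieldNormedType.Exports.
Set Implicit Arguments.
Unset Strict Implicit.
Unset Printing Implicit Defensive.

Local Open Scope classical_set_scope.
Local Open Scope ring_scope.

(* Substituting rho = phihat * phi and S = lambda * ln phi (Hopf-Cole) in the
   optimality system gives the coupled system, with or without any relation
   between g g^T and Sigma. The first order terms produced by the weighted
   Laplacian of rho * exp (- S / lambda) cancel those produced by the
   divergence of rho * Sigma * grad S because Sigma is symmetric; this symmetry
   is also what provides the derivatives of Sigma_ij * rho along both i and j.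
   When lambda g g^T = Sigma, f_phi and q_phi vanish identically and the
   coupled system is literally the linear one. *)

(** * Calculus rules for directional derivatives of scalar functions *)

Section directional_derivative.
Context (R : realType) (V : normedModType R).
Implicit Types (F G : V -> R) (x v : V).

Lemma is_derive_mul F G x v dF dG :
  is_derive x v F dF -> is_derive x v G dG ->
  is_derive x v (fun y => F y * G y) (F x * dG + G x * dF).
Proof. by move=> hF hG; apply: is_deriveM. Qed.

Lemma is_derive_add F G x v dF dG :
  is_derive x v F dF -> is_derive x v G dG ->
  is_derive x v (fun y => F y + G y) (dF + dG).
Proof. by move=> hF hG; apply: is_deriveD. Qed.

Lemma is_derive_scale k F x v dF :
  is_derive x v F dF -> is_derive x v (fun y => k * F y) (k * dF).
Proof. by move=> hF; apply: is_deriveZ. Qed.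

Lemma is_derive_sum_fun (n : nat) (h : 'I_n -> V -> R) (dh : 'I_n -> R) x v :
  (forall i, is_derive x v (h i) (dh i)) ->
  is_derive x v (fun y => \sum_i h i y) (\sum_i dh i).
Proof.
move=> hh; rewrite (_ : (fun y => _) = \sum_i h i); first exact: is_derive_sum.
by rewrite fct_sumE.
Qed.

(** The difference quotient of [F] at [x] along [v] is that of its restriction to the line through
    [x], taken at 0. One-variable chain rules thus apply to functions that are derivable along a
    single direction only. *)
Lemma is_derive_line F x v dF :
  is_derive x v F dF <-> is_derive (0 : R) 1 (fun h => F (h *: v + x)) dF.
Proof.
have E : (fun h : R => h^-1 *: ((F \o shift x) (h *: v) - F x)) =
    (fun h : R => h^-1 *: (((fun k => F (k *: v + x)) \o shift 0) (h *: 1)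
       - F (0 *: v + x))).
  by apply/funext => h /=; rewrite scale0r add0r addr0 [h%:A]mulr1.
split=> -[dv de]; split.
- by move: dv; rewrite /derivable E.
- by move: de; rewrite /derive E.
- by move: dv; rewrite /derivable E.
- by move: de; rewrite /derive E.
Qed.

(** The chain rule is applied on the line through [x]. As [V] is an arbitrary normed module, the
    rule serves both for space derivatives and, with [V] the real line, for time derivatives. *)
Lemma is_derive_expR_scale F x v dF k :
  is_derive x v F dF ->
  is_derive x v (fun y => expR (k * F y)) (k * expR (k * F x) * dF).
Proof.
move=> /is_derive_line hF; apply/is_derive_line.
have hk : is_derive (0 : R) 1 (fun h => k * F (h *: v + x)) (k * dF).
  exact: is_deriveZ.
have -> : k * expR (k * F x) * dF = expR (k * F (0 *: v + x)) * (k * dF).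
  by rewrite scale0r add0r; ring.
have he := is_derive_expR (k * F (0 *: v + x)).
exact: (@is_derive1_comp _ expR (fun h : R => k * F (h *: v + x)) _ _ _ he hk).
Qed.

End directional_derivative.

(** * Inner products, and the product rules for divergence, Hessian and weighted Laplacian *)

Section vector_calculus.
Context (R : realType) (n : nat).
Implicit Types (E F r : 'cV[R]_n -> R) (X Y : 'cV[R]_n -> 'cV[R]_n)
  (A : 'cV[R]_n -> 'M[R]_n) (x : 'cV[R]_n).

Lemma innerE (d : nat) (v w : 'cV[R]_d) : inner v w = \sum_i v i 0 * w i 0.
Proof. by apply: eq_bigr => i _; rewrite big_ord1. Qed.

Lemma innerDr (a b : nat) (v u w : 'M[R]_(a, b)) :
  inner v (u + w) = inner v u + inner v w.
Proof.
rewrite -big_split/=; apply: eq_bigr => i _; rewrite -big_split/=.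
by apply: eq_bigr => j _; rewrite !mxE mulrDr.
Qed.

Lemma innerZr (a b : nat) k (v w : 'M[R]_(a, b)) :
  inner v (k *: w) = k * inner v w.
Proof.
rewrite mulr_sumr; apply: eq_bigr => i _; rewrite mulr_sumr.
by apply: eq_bigr => j _; rewrite !mxE mulrCA.
Qed.

Lemma innerC (a b : nat) (v w : 'M[R]_(a, b)) : inner v w = inner w v.
Proof.
by apply: eq_bigr => i _; apply: eq_bigr => j _; rewrite mulrC.
Qed.

Lemma innerZl (a b : nat) k (v w : 'M[R]_(a, b)) :
  inner (k *: v) w = k * inner v w.
Proof. by rewrite innerC innerZr innerC. Qed.

Lemma inner_mulmxE (v w : 'cV[R]_n) (M : 'M[R]_n) :
  inner v (M *m w) = \sum_i \sum_j v i 0 * M i j * w j 0.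
Proof.
rewrite innerE; apply: eq_bigr => i _; rewrite mxE mulr_sumr.
by apply: eq_bigr => j _; rewrite mulrA.
Qed.

Lemma inner_trmx (d : nat) (v w : 'cV[R]_d) : inner v w = (v^T *m w) 0 0.
Proof. by rewrite innerE mxE; apply: eq_bigr => i _; rewrite mxE. Qed.

(** The quadratic form is the squared Euclidean norm of [A^T *m v]. *)
Lemma inner_gram_ge0 (k : nat) (A : 'M[R]_(n, k)) (v : 'cV[R]_n) :
  0 <= inner v (A *m A^T *m v).
Proof.
rewrite inner_trmx -mulmxA mulmxA -[v^T *m A]trmxK trmx_mul trmxK -inner_trmx.
by rewrite innerE; apply: sumr_ge0 => i _; rewrite -expr2 sqr_ge0.
Qed.

(** A formula for ['D_v] says nothing about existence, so every rule below asserts both; [is_derive]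
    delivers them together. *)
Lemma divergence_is_derive X (dX : 'cV[R]_n -> 'I_n -> R) :
  (forall i x, is_derive x (basis_vec R i) (fun y => X y i 0) (dX x i)) ->
  has_divergence X /\ forall x, divergence X x = \sum_i dX x i.
Proof.
move=> h; split=> [i x|x]; first by have [] := h i x.
by apply: eq_bigr => i _; have [] := h i x.
Qed.

Lemma divergence_scale E X : has_grad E -> has_divergence X ->
  has_divergence (fun x => E x *: X x) /\
  forall x, divergence (fun x => E x *: X x) x
    = E x * divergence X x + inner (grad E x) (X x).
Proof.
move=> hE hX.
have [i x|? hd] := @divergence_is_derive (fun x => E x *: X x) (fun x i =>
   E x * 'D_(basis_vec R i) (fun y => X y i 0) x
   + X x i 0 * 'D_(basis_vec R i) E x).
  rewrite (_ : (fun y => _) = fun y => E y * X y i 0); last first.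
    by apply/funext => y; rewrite mxE.
  exact: is_derive_mul (derivableP (hE i x)) (derivableP (hX i x)).
split=> // x; rewrite hd big_split/= -mulr_sumr innerE; congr (_ + _).
by apply: eq_bigr => i _; rewrite mxE mulrC.
Qed.

Lemma divergence_comb k X Y : has_divergence X -> has_divergence Y ->
  has_divergence (fun x => X x + k *: Y x) /\
  forall x, divergence (fun x => X x + k *: Y x) x
    = divergence X x + k * divergence Y x.
Proof.
move=> hX hY.
have [i x|? hd] := @divergence_is_derive (fun x => X x + k *: Y x) (fun x i =>
   'D_(basis_vec R i) (fun y => X y i 0) x
   + k * 'D_(basis_vec R i) (fun y => Y y i 0) x).
  rewrite (_ : (fun y => _) = fun y => X y i 0 + k * Y y i 0); last first.
    by apply/funext => y; rewrite !mxE.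
  apply: is_derive_add (derivableP (hX i x)) _.
  exact: is_derive_scale (derivableP (hY i x)).
by split=> // x; rewrite hd big_split/= -mulr_sumr.
Qed.

(** Component [i] of the field is differentiated along direction [i] only, so each [A i j] has to be
    derivable just in that direction. The second order terms of the product rule collect into the
    Frobenius product with the Hessian. *)
Lemma divergence_mulmx_grad A F :
  (forall i j x, derivable (fun y => A y i j) x (basis_vec R i)) ->
  has_hess F ->
  has_divergence (fun x => A x *m grad F x) /\
  forall x, divergence (fun x => A x *m grad F x) x
    = \sum_i \sum_j 'D_(basis_vec R i) (fun y => A y i j) x
                    * 'D_(basis_vec R j) F x
      + inner (A x) (hess F x).
Proof.
move=> hA hF.
have [i x|? hd] := @divergence_is_derive (fun x => A x *m grad F x) (fun x i =>
   \sum_j (A x i j * 'D_(basis_vec R i) ('D_(basis_vec R j) F) x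
     + 'D_(basis_vec R j) F x * 'D_(basis_vec R i) (fun y => A y i j) x)).
  rewrite (_ : (fun y => _) =
      fun y => \sum_j A y i j * 'D_(basis_vec R j) F y); last first.
    by apply/funext => y; rewrite mxE; apply: eq_bigr => j _; rewrite mxE.
  apply: is_derive_sum_fun => j.
  exact: is_derive_mul (derivableP (hA i j x)) (derivableP (hF j i x)).
split=> // x; rewrite hd /inner -big_split/=; apply: eq_bigr => i _.
rewrite -big_split/=; apply: eq_bigr => j _.
by rewrite mxE; ring.
Qed.

Lemma grad_expR_scale k F : has_grad F ->
  has_grad (fun y => expR (k * F y)) /\
  forall x, grad (fun y => expR (k * F y)) x
    = (k * expR (k * F x)) *: grad F x.
Proof.
move=> hF; have h i x := is_derive_expR_scale k (derivableP (hF i x)).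
split=> [i x|x]; first by have [] := h i x.
by apply/colP => i; rewrite !mxE; have [_ ->] := h i x.
Qed.

Lemma grad_ln_expR_scale k F x : has_grad F ->
  grad (fun y => ln (expR (k * F y))) x = k *: grad F x.
Proof.
move=> hF; apply/colP => i; rewrite !mxE.
rewrite (_ : (fun y => _) = fun y => k * F y); last first.
  by apply/funext => y; rewrite expRK.
by have [_ ->] := is_derive_scale k (derivableP (hF i x)).
Qed.

Lemma hess_expR_scale k F : has_grad F -> has_hess F ->
  has_hess (fun y => expR (k * F y)) /\
  forall x, hess (fun y => expR (k * F y)) x
    = expR (k * F x) *: (k ^+ 2 *: (grad F x *m (grad F x)^T) + k *: hess F x).
Proof.
move=> hF hHF; have [hE gE] := grad_expR_scale k hF.
have DE j : 'D_(basis_vec R j) (fun y => expR (k * F y)) =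
    fun x => k * (expR (k * F x) * 'D_(basis_vec R j) F x).
  apply/funext => x; have /colP/(_ j) := gE x; rewrite !mxE => ->.
  by rewrite mulrA.
have h i j x : is_derive x (basis_vec R i)
    ('D_(basis_vec R j) (fun y => expR (k * F y)))
    (k * (expR (k * F x) * 'D_(basis_vec R i) ('D_(basis_vec R j) F) x
       + 'D_(basis_vec R j) F x *
         (k * expR (k * F x) * 'D_(basis_vec R i) F x))).
  rewrite DE; apply: is_derive_scale.
  apply: is_derive_mul _ (derivableP (hHF j i x)).
  exact: is_derive_expR_scale (derivableP (hF i x)).
split=> [j i x|x]; first by have [] := h i j x.
apply/matrixP => i j; rewrite !mxE big_ord1 !mxE; have [_ ->] := h i j x.
by ring.
Qed.

(** The Frobenius product of [M] with the rank one part of the Hessian is the quadratic form of [M]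
    at the gradient. *)
Lemma inner_hess_expR_scale k F (M : 'M[R]_n) x : has_grad F -> has_hess F ->
  inner M (hess (fun y => expR (k * F y)) x)
  = expR (k * F x) * (k ^+ 2 * inner (grad F x) (M *m grad F x)
                      + k * inner M (hess F x)).
Proof.
move=> hF hHF; have [_ ->] := hess_expR_scale k hF hHF.
rewrite innerZr innerDr !innerZr; congr (_ * (_ * _ + _)).
rewrite inner_mulmxE; apply: eq_bigr => i _; apply: eq_bigr => j _.
by rewrite !mxE big_ord1 !mxE; ring.
Qed.

(** Two differentiations produce two cross terms for each pair of indices; exchanging the indices
    and using the symmetry of [A] shows that their double sums agree, whence the factor 2. *)
Lemma wlaplacian_mul A r E :
  (forall x i j, A x i j = A x j i) ->
  has_wlaplacian A r -> has_grad E -> has_hess E ->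
  has_wlaplacian A (fun y => r y * E y) /\
  forall x, wlaplacian A (fun y => r y * E y) x
    = E x * wlaplacian A r x
      + 2 * (\sum_i \sum_j 'D_(basis_vec R i) E x
               * 'D_(basis_vec R j) (fun y => A y i j * r y) x)
      + r x * inner (A x) (hess E x).
Proof.
move=> symA hr hE hHE.
have symD i j : (fun y => A y i j * r y) = (fun y => A y j i * r y).
  by apply/funext => y; rewrite symA.
have fE i j : (fun y => A y i j * (r y * E y)) =
    (fun y => (A y i j * r y) * E y).
  by apply/funext => y; rewrite mulrA.
have h1 i j x : is_derive x (basis_vec R j) (fun y => A y i j * (r y * E y))
   ((A x i j * r x) * 'D_(basis_vec R j) E x
    + E x * 'D_(basis_vec R j) (fun y => A y i j * r y) x).
  rewrite fE; have [h _] := hr i j.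
  exact: is_derive_mul (derivableP (h x)) (derivableP (hE j x)).
have DE i j : 'D_(basis_vec R j) (fun y => A y i j * (r y * E y)) =
   (fun x => (A x i j * r x) * 'D_(basis_vec R j) E x
    + E x * 'D_(basis_vec R j) (fun y => A y i j * r y) x).
  by apply/funext => x; have [] := h1 i j x.
have h2 i j x : is_derive x (basis_vec R i)
   ('D_(basis_vec R j) (fun y => A y i j * (r y * E y)))
   ((A x i j * r x) * 'D_(basis_vec R i) ('D_(basis_vec R j) E) x
    + 'D_(basis_vec R j) E x
      * 'D_(basis_vec R i) (fun y => A y i j * r y) x
    + (E x * 'D_(basis_vec R i)
               ('D_(basis_vec R j) (fun y => A y i j * r y)) x
       + 'D_(basis_vec R j) (fun y => A y i j * r y) x
         * 'D_(basis_vec R i) E x)).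
  rewrite DE; apply: is_derive_add.
    apply: is_derive_mul _ (derivableP (hHE j i x)).
    (* [hr i j] differentiates entry [(i, j)] along [j] first; the derivative along [i] comes from
       the transposed entry. *)
    by rewrite symD; have [h _] := hr j i; exact: derivableP.
  have [_ h] := hr i j.
  exact: is_derive_mul (derivableP (hE i x)) (derivableP (h x)).
split=> [i j|x].
  by split=> x; [have [] := h1 i j x|have [] := h2 i j x].
set m := \sum_i _; have mE : m = \sum_i \sum_j 'D_(basis_vec R j) E x
      * 'D_(basis_vec R i) (fun y => A y i j * r y) x.
  rewrite /m exchange_big; apply: eq_bigr => i _; apply: eq_bigr => j _ /=.
  by rewrite symD.
(* The factor 2 is split into one copy of each form of the cross sum, so that the identity holds
   term by term in [(i, j)]. *)
rewrite mulr2n mulrDl mul1r {1}mE /m /wlaplacian /inner !mulr_sumr.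
rewrite -!big_split/=; apply: eq_bigr => i _.
rewrite !mulr_sumr -!big_split/=; apply: eq_bigr => j _.
have [_ ->] := h2 i j x.
rewrite mxE.
move: ('D_(basis_vec R i) ('D_(basis_vec R j) E) x) ('D_(basis_vec R j) E x)
  ('D_(basis_vec R i) E x) => d2E djE diE.
by ring.
Qed.

End vector_calculus.

(** Around an interior point the restriction to [[a, b]] is void for small increments, so the limit
    in [C1_itv] is the usual two-sided derivative. *)
Lemma C1_itv_derivable (R : realType) (a b t : R) (F : R -> R) :
  C1_itv a b F -> t \in `]a, b[ -> derivable F t 1.
Proof.
move=> [dF [hF _]] tab; apply/cvg_ex; exists (dF t) => /= A.
move=> /(hF t (subset_itv_oo_cc tab)) [e /= e0 eA].
have [d /= d0 dab] : nbhs t `]a, b[%classic.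
  exact: near_in_itvoo.
(* [e] controls the difference quotient and [d] keeps [h + t] inside the interval. *)
exists (Num.min e d) => /=; first by rewrite lt_min e0.
move=> h /= hed h0; have {}hed : `|h| < e /\ `|h| < d.
  by apply/andP; rewrite -lt_min -normrN -sub0r.
have tE : t - (h + t) = - h by lra.
have := eA (h + t); rewrite /= tE normrN.
have htt : h + t != t by rewrite -subr_eq0 addrK.
move=> /(_ hed.1 htt) hA; rewrite [h%:A]mulr1 /preimage /=.
suff : A ((F (h + t) - F t) / (h + t - t)) by rewrite addrK mulrC.
apply: hA; apply: subset_itv_oo_cc.
by apply: (dab (h + t)); rewrite /= tE normrN hed.2.
Qed.

(** * Proportional Gram matrices, the reduction to linear equations, and the Hopf-Cole
    substitution *)

Section control.
Context (R : realType) (n m p : nat) (t0 t1 : R).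
Context (f : R -> 'cV[R]_n -> 'cV[R]_n) (g : R -> 'cV[R]_n -> 'M[R]_(n, m))
  (sigma : R -> 'cV[R]_n -> 'M[R]_(n, p)) (q : R -> 'cV[R]_n -> R).

Lemma Sigma_sym t x i j : Sigma sigma t x i j = Sigma sigma t x j i.
Proof.
by rewrite !mxE; apply: eq_bigr => k _; rewrite !mxE mulrC.
Qed.

(* A2 makes Sigma nonzero as soon as n > 0, and both Gram matrices are positive
   semidefinite, so the proportionality factor is positive. *)
Lemma proportional_gramP : t0 <= t1 -> assumption_A2 t0 t1 sigma ->
  (exists2 c : R, c != 0 & forall t x, t \in `[t0, t1] ->
      g t x *m (g t x)^T = c *: (sigma t x *m (sigma t x)^T)) <->
  (exists2 lambda : R, 0 < lambda & forall t x, t \in `[t0, t1] ->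
      lambda *: (g t x *m (g t x)^T) - Sigma sigma t x = 0).
Proof.
move=> t01 [c3 c30 hc3]; split; last first.
  move=> [l l0 hl]; exists l^-1; first by rewrite invr_neq0// gt_eqF.
  move=> t x tt; have /eqP := hl t x tt; rewrite subr_eq0 => /eqP.
  by rewrite /Sigma => <-; rewrite scalerA mulVf ?scale1r// gt_eqF.
move=> [c c0 hc]; case: (posnP n) => [n0|n_gt0].
  (* In dimension 0 the matrices have no entries, so any positive factor works. *)
  exists 1 => // t x _; apply/matrixP => i; exfalso.
  by have := leq_ltn_trans (leq0n i) (ltn_ord i); rewrite [X in (_ < X)%N]n0.
have c_gt0 : 0 < c.
  have tt : t0 \in `[t0, t1] by rewrite in_itv/= lexx t01.
  (* A nonzero vector, used both as the state at which [Sigma] is evaluated and as the argument of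
     its quadratic form, since A2 ties the two together. *)
  pose v : 'cV[R]_n := const_mx 1.
  have v0 : 0 < inner v v.
    rewrite innerE (eq_bigr (fun=> 1)).
      by rewrite sumr_const card_ord ltr0n.
    by move=> i _; rewrite mxE mulr1.
  have := inner_gram_ge0 (g t0 v) v; rewrite (hc t0 v tt).
  rewrite -scalemxAl innerZr => cs.
  have s0 : 0 < inner v (Sigma sigma t0 v *m v).
    apply: lt_le_trans (hc3 t0 v tt).
    by rewrite mulr_gt0// exprn_gt0// sqrtr_gt0.
  by rewrite lt_neqAle eq_sym c0/= -(pmulr_lge0 _ s0).
exists c^-1; first by rewrite invr_gt0.
by move=> t x tt; rewrite hc// scalerA mulVf// scale1r subrr.
Qed.

(** [f_] and [q_] are linear in the mismatch, so both vanish at the interior times where the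
    equations are imposed. *)
Lemma coupled_linear_iff (lambda : R) (rho0 rho1 : 'cV[R]_n -> R)
    (psihat psi : R -> 'cV[R]_n -> R) :
  (forall t x, t \in `[t0, t1] -> mismatch g sigma lambda t x = 0) ->
  coupled_system t0 t1 f g sigma q lambda rho0 rho1 psihat psi <->
  linear_system t0 t1 f sigma q lambda rho0 rho1 psihat psi.
Proof.
move=> h.
have f0 t x : t \in `]t0, t1[ -> f_ g sigma lambda psi t x = 0.
  by move=> tt; rewrite /f_ h ?mul0mx//; exact: subset_itv_oo_cc.
have q0 t x : t \in `]t0, t1[ -> q_ g sigma lambda psi t x = 0.
  move=> tt; rewrite /q_ h ?mulmx0 ?mul0mx ?mxE ?mulr0//.
  exact: subset_itv_oo_cc.
(* The fields are equated as functions of [x], because [divergence] differentiates them. *)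
have X0 t : t \in `]t0, t1[ ->
    (fun x => psihat t x *: (f t x + f_ g sigma lambda psi t x))
    = (fun x => psihat t x *: f t x).
  by move=> tt; apply/funext => x; rewrite f0// addr0.
split=> -[reg eqhat eqpsi b0 b1].
split; [| | |exact: b0|exact: b1].
- by move=> t tt; have := reg t tt; rewrite X0.
- by move=> t x tt; rewrite -(eqhat t x tt) X0// q0// addr0 mulrAC.
- by move=> t x tt; rewrite -(eqpsi t x tt) f0// q0// !addr0 mulrAC.
split; [| | |exact: b0|exact: b1].
- by move=> t tt; have := reg t tt; rewrite X0.
- by move=> t x tt; rewrite -(eqhat t x tt) X0// q0// addr0 mulrAC.
- by move=> t x tt; rewrite -(eqpsi t x tt) f0// q0// !addr0 mulrAC.
Qed.

(** Here [ln phi] is [S / lambda], and its factor [lambda^-1] cancels the [lambda] in front of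
    [ggT]. *)
Lemma f_expR lambda (S : R -> 'cV[R]_n -> R) t x : lambda != 0 ->
  has_grad (S t) ->
  f_ g sigma lambda (fun t x => expR (lambda^-1 * S t x)) t x
  = ggT g t x *m grad (S t) x
    + - lambda^-1 *: (Sigma sigma t x *m grad (S t) x).
Proof.
move=> l0 hS; rewrite /f_ grad_ln_expR_scale//.
rewrite -scalemxAr /mismatch mulmxBl scalerBr -scalemxAl scalerA mulVf//.
by rewrite scale1r scaleNr.
Qed.

(** [q_] is half the inner product of the gradient of [ln phi] with [f_]. *)
Lemma q_expR lambda (S : R -> 'cV[R]_n -> R) t x : lambda != 0 ->
  has_grad (S t) ->
  q_ g sigma lambda (fun t x => expR (lambda^-1 * S t x)) t x
  = 2^-1 * lambda^-1 * (inner (grad (S t) x) (ggT g t x *m grad (S t) x)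
    - lambda^-1 * inner (grad (S t) x) (Sigma sigma t x *m grad (S t) x)).
Proof.
move=> l0 hS; have := f_expR x l0 hS; rewrite /f_ /q_ -mulmxA => ->.
rewrite -inner_trmx grad_ln_expR_scale//.
by rewrite innerZl innerDr innerZr; ring.
Qed.

Lemma coupled_system_hopf_cole lambda rho0 rho1 (rho S : R -> 'cV[R]_n -> R) :
  lambda != 0 -> C12 t0 t1 S ->
  optimality_system t0 t1 f g sigma q rho0 rho1 rho S ->
  coupled_system t0 t1 f g sigma q lambda rho0 rho1
    (fun t x => rho t x * expR (- lambda^-1 * S t x))
    (fun t x => expR (lambda^-1 * S t x)).
Proof.
move=> l0 [S1 S2] [reg eqrho eqS rho0E rho1E].
have bnd t x : rho t x * expR (- lambda^-1 * S t x) * expR (lambda^-1 * S t x)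
    = rho t x.
  by rewrite -mulrA -expRD mulNr addNr expR0 mulr1.
have St t x : t \in `]t0, t1[ -> is_derive t 1 (S ^~ x) (derive1 (S ^~ x) t).
  by move=> /(C1_itv_derivable (S1 x)) /derivableP; rewrite derive1E.
have phit k t x : t \in `]t0, t1[ ->
    is_derive t 1 (fun s => expR (k * S s x))
      (k * expR (k * S t x) * derive1 (S ^~ x) t).
  by move=> tt; exact: (is_derive_expR_scale k (St t x tt)).
have phihatt t x : t \in `]t0, t1[ ->
    is_derive t 1 (fun s => rho s x * expR (- lambda^-1 * S s x))
      (expR (- lambda^-1 * S t x)
       * (derive1 (rho ^~ x) t
          - rho t x * lambda^-1 * derive1 (S ^~ x) t)).
  move=> tt; have [/(_ x)/derivableP rt _ _] := reg t tt.
  apply: is_derive_eq (is_derive_mul rt (phit (- lambda^-1) t x tt)) _.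
  by rewrite -derive1E; ring.
(* Divergence and Laplacian are treated together: the terms with first derivatives of
   [Sigma_ij * rho] cancel only in this combination. *)
have space t : t \in `]t0, t1[ ->
    let X x := rho t x *: (f t x + ggT g t x *m grad (S t) x) in
    let Xhat x := rho t x * expR (- lambda^-1 * S t x) *:
       (f t x + f_ g sigma lambda (fun t x => expR (lambda^-1 * S t x)) t x) in
    [/\ has_divergence Xhat,
      has_wlaplacian (Sigma sigma t)
        (fun x => rho t x * expR (- lambda^-1 * S t x))
      & forall x, divergence Xhat x - 2^-1 * wlaplacian (Sigma sigma t)
          (fun x => rho t x * expR (- lambda^-1 * S t x)) x
        = expR (- lambda^-1 * S t x) * (divergence X x
            - 2^-1 * wlaplacian (Sigma sigma t) (rho t) x
            - rho t x * lambda^-1 *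
              (inner (grad (S t) x) (f t x)
               + inner (grad (S t) x) (ggT g t x *m grad (S t) x)
               - 2^-1 * lambda^-1 *
                 inner (grad (S t) x) (Sigma sigma t x *m grad (S t) x)
               + 2^-1 * inner (Sigma sigma t x) (hess (S t) x)))].
  move=> tt X Xhat; have [gS hS _ _] := S2 t (subset_itv_oo_cc tt).
  have [_ hX hW] := reg t tt.
  (* Regularity is available for the products [Sigma_ij * rho], not for the two factors separately,
     so the product is kept as one matrix field. *)
  pose A x := \matrix_(i, j) (Sigma sigma t x i j * rho t x).
  have AE x : A x = rho t x *: Sigma sigma t x.
    by apply/matrixP => i j; rewrite !mxE mulrC.
  have symD i j : (fun y => A y i j) = (fun y => Sigma sigma t y j i * rho t y).
    by apply/funext => y; rewrite mxE Sigma_sym.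
  have hA i j x : derivable (fun y => A y i j) x (basis_vec R i).
    by rewrite symD; have [h _] := hW j i; exact: h.
  have [hY dY] := divergence_mulmx_grad hA hS.
  have [hXY dXY] := divergence_comb (- lambda^-1) hX hY.
  have [gE DE] := grad_expR_scale (- lambda^-1) gS.
  have [hE _] := hess_expR_scale (- lambda^-1) gS hS.
  have [hZ dZ] := divergence_scale gE hXY.
  have [hWE dWE] := wlaplacian_mul (Sigma_sym t) hW gE hE.
  (* Factoring out the exponential leaves two fields whose divergences are known to exist, [X] and
     [A *m grad S]. *)
  have XhatE : Xhat = fun x => expR (- lambda^-1 * S t x) *:
     (X x + - lambda^-1 *: (A x *m grad (S t) x)).
    apply/funext => x; rewrite /Xhat f_expR// AE -scalemxAl.
    by rewrite /X; apply/colP => i; rewrite !mxE; ring.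
  split=> [|//|x]; first by rewrite XhatE.
  rewrite XhatE dZ dXY dY dWE DE.
  have -> := inner_hess_expR_scale (- lambda^-1) (Sigma sigma t x) x gS hS.
  rewrite innerZl innerDr innerZr AE -scalemxAl /X !innerZr innerDr.
  rewrite [inner (_ *: _) (hess _ _)]innerC innerZr [inner (hess _ _) _]innerC.
  (* [M] comes from the divergence of [A *m grad S], [M'] from the cross terms of the Laplacian. The
     factor 2 of the latter meets [2^-1], and the two contributions cancel once [M'] is expressed
     through [M]. *)
  set M := \sum_i \sum_j _ * _; set M' := \sum_i \sum_j _ * _.
  have -> : M' = - lambda^-1 * expR (- lambda^-1 * S t x) * M.
    rewrite /M' exchange_big mulr_sumr; apply: eq_bigr => i _.
    rewrite mulr_sumr; apply: eq_bigr => j _.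
    have /colP/(_ j) := DE x; rewrite !mxE => ->.
    by rewrite symD -!mulrA [X in _ * (_ * X)]mulrC.
  by field.
split.
- move=> t tt; have [hX hW _] := space t tt.
  have [gS hS _ _] := S2 t (subset_itv_oo_cc tt).
  split; split.
  + by move=> x; have [] := phihatt t x tt.
  + exact: hX.
  + exact: hW.
  + by move=> x; have [] := phit lambda^-1 t x tt.
  + exact: (grad_expR_scale _ gS).1.
  + exact: (hess_expR_scale _ gS hS).1.
- move=> t x tt; have [_ _ dE] := space t tt.
  have [gS hS _ _] := S2 t (subset_itv_oo_cc tt).
  rewrite derive1E; have [_ ->] := phihatt t x tt.
  (* Replacing [q] by the left-hand side of the Hamilton-Jacobi equation leaves the exponential
     times the residual of the density equation, which is zero by [e]. *)
  rewrite -(addrA (_ * _)) dE (q_expR _ l0 gS) -(eqS t x tt).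
  have /eqP := eqrho t x tt; rewrite -subr_eq0 => /eqP e.
  rewrite -[RHS](mulr0 (expR (- lambda^-1 * S t x))) -[X in _ = _ * X]e.
  by field.
- move=> t x tt; have [gS hS _ _] := S2 t (subset_itv_oo_cc tt).
  rewrite derive1E; have [_ ->] := phit lambda^-1 t x tt.
  (* With [q] eliminated in the same way, the backward equation becomes an algebraic identity. *)
  rewrite (f_expR _ l0 gS) (q_expR _ l0 gS) -(eqS t x tt) (grad_expR_scale _ gS).2.
  have -> := inner_hess_expR_scale lambda^-1 (Sigma sigma t x) x gS hS.
  rewrite innerZl !innerDr innerZr.
  by field.
- by move=> x; rewrite bnd rho0E.
- by move=> x; rewrite bnd rho1E.
Qed.

End control.

Theorem corollary1 (R : realType) (n m p : nat) (t0 t1 : R)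
  (f : R -> 'cV[R]_n -> 'cV[R]_n) (g : R -> 'cV[R]_n -> 'M[R]_(n, m))
  (sigma : R -> 'cV[R]_n -> 'M[R]_(n, p)) (q : R -> 'cV[R]_n -> R)
  (rho0 rho1 : 'cV[R]_n -> R) (rho S : R -> 'cV[R]_n -> R)
  (ht : t0 < t1)
  (hA1 : assumption_A1 t0 t1 f sigma)
  (hA2 : assumption_A2 t0 t1 sigma)
  (hq : {within `[t0, t1] `*` [set: 'cV[R]_n],
           continuous (fun z : R * 'cV[R]_n => q z.1 z.2)})
  (hrho0 : is_pdf rho0) (hrho0' : finite_second_moment rho0)
  (hrho1 : is_pdf rho1) (hrho1' : finite_second_moment rho1)
  (hrho : density_curve t0 t1 rho0 rho1 rho)
  (hS : C12 t0 t1 S)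
  (hsys : optimality_system t0 t1 f g sigma q rho0 rho1 rho S) :
  ((exists2 c : R, c != 0 & forall t x, t \in `[t0, t1] ->
      g t x *m (g t x)^T = c *: (sigma t x *m (sigma t x)^T)) <->
   (exists2 lambda : R, 0 < lambda & forall t x, t \in `[t0, t1] ->
      lambda *: (g t x *m (g t x)^T) - Sigma sigma t x = 0)) /\
  forall lambda : R, 0 < lambda ->
    let phihat := fun t x => rho t x * expR (- S t x / lambda) in
    let phi := fun t x => expR (S t x / lambda) in
    coupled_system t0 t1 f g sigma q lambda rho0 rho1 phihat phi /\
    ((forall t x, t \in `[t0, t1] ->
        lambda *: (g t x *m (g t x)^T) - Sigma sigma t x = 0) ->
     linear_system t0 t1 f sigma q lambda rho0 rho1 phihat phi /\
     (forall psihat psi : R -> 'cV[R]_n -> R,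
        (forall t x, t \in `[t0, t1] -> 0 < psi t x) ->
        coupled_system t0 t1 f g sigma q lambda rho0 rho1 psihat psi <->
        linear_system t0 t1 f sigma q lambda rho0 rho1 psihat psi)).
Proof.
split; first exact: proportional_gramP (ltW ht) hA2.
move=> lambda l0 phihat phi.
have coupled : coupled_system t0 t1 f g sigma q lambda rho0 rho1 phihat phi.
  (* The exponents are brought to the form [k * S] in which the substitution was carried out. *)
  have -> : phihat = fun t x => rho t x * expR (- lambda^-1 * S t x).
    by apply/funext => t; apply/funext => x; rewrite /phihat [- S t x / _]mulrC mulrN mulNr.
  have -> : phi = fun t x => expR (lambda^-1 * S t x).
    by apply/funext => t; apply/funext => x; rewrite /phi mulrC.
  exact: coupled_system_hopf_cole (lt0r_neq0 l0) hS hsys.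
split=> [|hprop]; first exact: coupled.
have reduce psihat psi := coupled_linear_iff f q rho0 rho1 psihat psi hprop.
split; first exact: (reduce phihat phi).1 coupled.
by move=> psihat psi _; exact: reduce psihat psi.
Qed.
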